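(* Let $G$ be a triangle-free graph in which every vertex has odd degree. Then the complement $\overline{G}$ has an odd spanning tree if and only if $G$ is not isomorphic to $2K_2$ and $G$ is not a complete bipartite graph.
   Context: All graphs are finite and simple. The complement $\overline{G}$ has vertex set $V(G)$, two vertices being adjacent in $\overline{G}$ iff they are not adjacent in $G$. An odd spanning tree is a spanning tree in which every vertex has odd degree. $2K_2$ denotes the graph consisting of two vertex-disjoint edges (the complement of the $4$-cycle $C_4$). A complete bipartite graph is $K_{s,t}$ for positive integers $s,t$. *)

(* Defs.v *)
From mathcomp Require Import all_boot.

Set Implicit Arguments.
Unset Strict Implicit.
Unset Printing Implicit Defensive.

Record sgraph (V : finType) := SGraph {
  adj : rel V;
  adj_sym : symmetric adj;
  adj_irr : irreflexive adj }.

Section Notions.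
Variables (V : finType) (G : sgraph V).

Definition deg (x : V) : nat := #|[set y | adj G x y]|.

Definition all_odd_deg : Prop := forall x, odd (deg x).

Definition triangle_free : Prop :=
  forall x y z, ~~ [&& adj G x y, adj G y z & adj G z x].

Definition compl_adj : rel V := [rel x y | (x != y) && ~~ adj G x y].

Lemma compl_sym : symmetric compl_adj.
Proof. by move=> x y; rewrite /compl_adj /= eq_sym adj_sym. Qed.

Lemma compl_irr : irreflexive compl_adj.
Proof. by move=> x; rewrite /compl_adj /= eqxx. Qed.

Definition compl : sgraph V := SGraph compl_sym compl_irr.

Definition connected : Prop := forall x y, connect (adj G) x y.

(* The size bound is needed: [:: x; y] satisfies ucycle for every edge xy. *)
Definition acyclic : Prop :=
  forall c : seq V, 2 < size c -> ~ ucycle (adj G) c.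

Definition is_tree : Prop := connected /\ acyclic.

End Notions.

(* A spanning subgraph of G is a graph on the same vertex type V. *)
Definition spanning_tree (V : finType) (G T : sgraph V) : Prop :=
  subrel (adj T) (adj G) /\ is_tree T.

Definition has_odd_spanning_tree (V : finType) (G : sgraph V) : Prop :=
  exists T : sgraph V, spanning_tree G T /\ all_odd_deg T.

Definition isomorphic (V W : finType) (G : sgraph V) (H : sgraph W) : Prop :=
  exists2 f : V -> W,
    bijective f & forall x y, adj H (f x) (f y) = adj G x y.

(* 2K_2: the first component selects the edge, the second its endpoint. *)
Definition twoK2_adj : rel (bool * bool) :=
  [rel u v | (u.1 == v.1) && (u.2 != v.2)].

Lemma twoK2_sym : symmetric twoK2_adj.
Proof. by move=> u v; rewrite /twoK2_adj /= eq_sym [u.2 == _]eq_sym. Qed.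

Lemma twoK2_irr : irreflexive twoK2_adj.
Proof. by move=> u; rewrite /twoK2_adj /= !eqxx. Qed.

Definition twoK2 : sgraph (bool * bool)%type := SGraph twoK2_sym twoK2_irr.

Section CompleteBipartite.
Variables s t : nat.

Definition Kst_adj : rel ('I_s + 'I_t) :=
  fun u v => match u, v with
             | inl _, inr _ | inr _, inl _ => true
             | _, _ => false
             end.

Lemma Kst_sym : symmetric Kst_adj.
Proof. by case=> i; case=> j. Qed.

Lemma Kst_irr : irreflexive Kst_adj.
Proof. by case. Qed.

Definition Kst : sgraph ('I_s + 'I_t)%type := SGraph Kst_sym Kst_irr.

End CompleteBipartite.

Definition complete_bipartite (V : finType) (G : sgraph V) : Prop :=
  exists s t : nat, [/\ 0 < s, 0 < t & isomorphic G (Kst s t)].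

(* Main.v *)
Require Import Defs.
From mathcomp Require Import all_boot.
From mathcomp Require Import zify.

Set Implicit Arguments.
Unset Strict Implicit.
Unset Printing Implicit Defensive.

(**
  Let [uv] be an edge of [G] and [c] a vertex adjacent to neither end.  If [c]
  has a further non-neighbour [w], which we may take non-adjacent to [v] by
  exchanging [u] and [v], then an odd spanning tree of the complement consists
  of the edges [cu], [cv], [cw], of edges from [u] to the neighbours of [v], and
  of edges from [v] to all remaining vertices: [c] has degree 3, the degree of
  [u] is [deg G v], and that of [v] is odd because the order of [G] is even.  If
  no vertex outside N(u) and N(v) has such a [w], then by parity there are two
  vertices outside, and G = 2K_2.  If every edge of [G] is dominating, then [G]
  is complete bipartite.
*)

(** * Trees given by a parent map with decreasing rank *)

Section ParentGraph.
Variables (V : finType) (p : V -> V).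

(** The root is a fixed point of [p]; requiring [x != y] discards the loop this would create. *)
Definition parent_adj : rel V := [rel x y | (x != y) && ((p x == y) || (p y == x))].

Lemma parent_sym : symmetric parent_adj.
Proof. by move=> x y; rewrite /parent_adj /= eq_sym orbC. Qed.

Lemma parent_irr : irreflexive parent_adj.
Proof. by move=> x; rewrite /parent_adj /= eqxx. Qed.

Definition parent_graph : sgraph V := SGraph parent_sym parent_irr.

Variables (root : V) (rank : V -> nat).
Hypothesis rank_parent : forall x, x != root -> rank (p x) < rank x.
Hypothesis parent_root : p root = root.

Lemma parent_graph_connected : connected parent_graph.
Proof.
have to_root x : connect parent_adj x root.
  elim: {x}(rank x) {-2}x (leqnn (rank x)) => [|n IHn] x.
    by case: (eqVneq x root) => [->|/rank_parent]; [rewrite connect0 | lia].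
  case: (eqVneq x root) => [->|xr lexn]; first by rewrite connect0.
  have ltpx := rank_parent xr; apply: (@connect_trans _ _ (p x)); last by apply: IHn; lia.
  by apply: connect1; rewrite /parent_adj /= eqxx andbT; apply: contraTneq ltpx => <-; rewrite ltnn.
move=> x y; apply: (connect_trans (to_root x)).
by rewrite (sym_connect_sym parent_sym).
Qed.

(* A vertex of maximal rank on a cycle can only be followed and preceded by
   its parent. *)
Lemma parent_graph_acyclic : acyclic parent_graph.
Proof.
move=> [//|x0 s] sz /andP[cyc unq].
have x0s : x0 \in x0 :: s by rewrite mem_head.
case: (arg_maxnP rank x0s) => x xs xmax.
(* If [x] were the parent of a non-root [y], then [y] would have larger rank than [x], against
   maximality. *)
have nbr_parent y : y \in x0 :: s -> parent_adj x y -> y = p x.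
  move=> ys /andP[xy /orP[/eqP->//|/eqP pyx]]; have [yr|/rank_parent] := eqVneq y root.
    by move: xy; rewrite -pyx yr parent_root eqxx.
  by have /= := xmax _ ys; rewrite pyx; lia.
case: (rot_to xs) => i t def_t.
have mem_t y : (y \in x :: t) = (y \in x0 :: s) by rewrite -def_t mem_rot.
move: cyc unq sz; rewrite -(rot_cycle i) -(rot_uniq i) -(size_rot i) def_t.
(* The cycle now starts at [x]. Having length at least 3, it has distinct positions for the
   successor [y] and the predecessor [z], yet both are [p x]. *)
case: t {def_t} mem_t => [//|y t]; case/lastP: t => [//|t z] mem_t.
rewrite /= rcons_path last_rcons => /andP[xy /andP[_ zx]] /andP[_ /andP[ynt _]] _.
move: ynt; rewrite (nbr_parent y) -?mem_t ?inE ?eqxx ?orbT //.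
by rewrite -(nbr_parent z) -?mem_t ?inE ?mem_rcons ?inE ?eqxx ?orbT // parent_sym.
Qed.

End ParentGraph.

(** * Parity of degrees and of the order *)

Section Degrees.
Variables (V : finType) (G : sgraph V).

(** [below] counts each edge once, at its end of smaller [enum_rank]. *)
Lemma handshake : ~~ odd (\sum_x deg G x).
Proof.
pose below x y := adj G x y && (enum_rank x < enum_rank y).
suff -> : \sum_x deg G x = (\sum_x \sum_y below x y).*2 by rewrite odd_double.
rewrite -addnn [X in _ = _ + X]exchange_big -big_split /=; apply: eq_bigr => x _.
rewrite /deg -sum1_card big_mkcond -big_split /=; apply: eq_bigr => y _.
rewrite inE /below [adj G y x]adj_sym; case: (boolP (adj G x y)) => //= xy.
have: enum_rank x != enum_rank y.
  by rewrite (inj_eq enum_rank_inj); apply: contraTneq xy => ->; rewrite adj_irr.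
by rewrite neq_ltn; case: ltngtP.
Qed.

Lemma all_odd_deg_order : all_odd_deg G -> ~~ odd #|V|.
Proof.
move=> oddG; have := handshake; rewrite -sum1_card.
rewrite (big_morph odd oddD (erefl : odd 0 = false)).
rewrite (big_morph odd oddD (erefl : odd 0 = false)).
by under eq_bigr do rewrite oddG.
Qed.

Lemma odd_deg_neighbour x : odd (deg G x) -> exists y, adj G x y.
Proof.
rewrite /deg => oddx; have /card_gt0P[y] : 0 < #|[set y | adj G x y]| by apply: odd_gt0.
by rewrite inE; exists y.
Qed.

End Degrees.

(** * The two exceptional families *)

Section Graphs.
Variables (V : finType) (G : sgraph V).

(** The complement is a 4-cycle, so odd degrees in [T] must all be 1. Then [T] is a matching, and
    one of its edges is already a whole component. *)
Lemma twoK2_no_odd_spanning_tree :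
  isomorphic G twoK2 -> ~ has_odd_spanning_tree (compl G).
Proof.
move=> [f bij_f f_adj] [T [[sTG [conT _]] oddT]].
have cardV : #|V| = 4 by rewrite (bij_eq_card bij_f) card_prod card_bool.
have degT x : deg T x = 1.
  (* [x'] is the other end of the edge of [G] at [x]; a neighbour of [x] in [T] avoids both. *)
  have [g gK fK] := bij_f; pose x' := g ((f x).1, ~~ (f x).2).
  have xx' : adj G x x' by rewrite -f_adj fK /= /twoK2_adj /= eqxx; case: (f x).2.
  have x'x : x != x' by apply: contraTneq xx' => <-; rewrite adj_irr.
  have : deg T x <= #|~: [set x; x']|.
    apply/subset_leq_card/subsetP => y; rewrite !inE => /sTG /= /andP[xy nxy].
    by rewrite negb_or eq_sym xy; apply: contra nxy => /eqP->.
  have := cardsC [set x; x']; rewrite cards2 x'x cardV.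
  by have := oddT x; case: (deg T x) => [|[|[|]]] //; lia.
have nbr_uniq x y z : adj T x y -> adj T x z -> y = z.
  have /eqP/cards1P[t /setP def_t] := degT x.
  by have := def_t y; have := def_t z; rewrite !inE => -> -> /eqP-> /eqP->.
have /card_gt0P[x _] : 0 < #|V| by rewrite cardV.
have [y xy] : exists y, adj T x y by apply: odd_deg_neighbour.
have clos : closed (adj T) (mem [set x; y]).
  apply: intro_closed; first exact: (sym_connect_sym (@adj_sym _ T)).
  move=> a b ab; rewrite !inE => /orP[]/eqP ea; move: ab; rewrite ea => ab.
    by rewrite (nbr_uniq x b y) ?eqxx ?orbT.
  by rewrite (nbr_uniq y b x) ?eqxx // adj_sym.
have : #|V| <= #|[set x; y]|.
  apply/subset_leq_card/subsetP => z _.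
  by rewrite -(closed_connect clos (conT x z)) !inE eqxx.
by rewrite cardV cards2; case: (x != y).
Qed.

(** No edge of the complement joins the two sides, and both are nonempty. *)
Lemma complete_bipartite_no_spanning_tree (T : sgraph V) :
  complete_bipartite G -> ~ spanning_tree (compl G) T.
Proof.
move=> [s [t [s_gt0 t_gt0 [f [g gK fK] f_adj]]]] [sTG [conT _]].
pose left := [pred x | if f x is inl _ then true else false].
have clos : closed (adj T) left.
  move=> x y /sTG /= /andP[_]; rewrite -f_adj !inE.
  by case: (f x) => i; case: (f y) => j.
have := closed_connect clos
  (conT (g (inl (Ordinal s_gt0))) (g (inr (Ordinal t_gt0)))).
by rewrite !inE !fK.
Qed.

(** * Graphs in which every edge is dominating *)

Lemma complete_bipartite_of_bipartition (A : {set V}) x0 y0 :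
  x0 \in A -> y0 \notin A ->
  (forall x y, adj G x y = ((x \in A) != (y \in A))) -> complete_bipartite G.
Proof.
move=> x0A; rewrite -in_setC => y0A adjA.
exists #|A|, #|~: A|; split; [by apply/card_gt0P; exists x0 | by apply/card_gt0P; exists y0 |].
(* The membership proofs [x0A] and [y0A] provide the default values of [enum_rank_in]. *)
pose f x : 'I_#|A| + 'I_#|~: A| :=
  if x \in A then inl (enum_rank_in x0A x) else inr (enum_rank_in y0A x).
exists f; last by move=> x y; rewrite adjA /f; case: (x \in A); case: (y \in A).
exists (fun s => match s with inl i => enum_val i | inr i => enum_val i end).
  by move=> x; rewrite /f; case: ifP => xA; rewrite enum_rankK_in // inE xA.
case=> i; rewrite /f; first by rewrite enum_valP enum_valK_in.
by have := enum_valP i; rewrite inE => /negbTE->; rewrite enum_valK_in.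
Qed.

Hypothesis triG : triangle_free G.
Hypothesis oddG : all_odd_deg G.

Lemma no_triangle x y z : adj G x y -> adj G x z -> adj G y z = false.
Proof.
by move=> xy xz; have := triG x y z; rewrite xy [adj G z x]adj_sym xz andbT => /negbTE.
Qed.

(** For an edge [x0 y0], domination and triangle-freeness put each vertex in exactly one of the two
    neighbourhoods, which are independent sets. All cross edges exist because each edge from [x0] to
    [x] dominates the non-neighbours of [x0]. *)
Lemma dominating_edges_complete_bipartite (x0 : V) :
  (forall x y z, adj G x y -> adj G x z || adj G y z) -> complete_bipartite G.
Proof.
move=> dom; have [y0 xy0] := odd_deg_neighbour (oddG x0).
have nA x : (adj G y0 x) = ~~ (adj G x0 x).
  have := dom _ _ x xy0; case: (boolP (adj G x0 x)) => //= x0x _.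
  exact: no_triangle xy0 x0x.
have cross x y : adj G x0 x -> ~~ adj G x0 y -> adj G x y.
  move=> x0x nx0y; have := dom _ _ y x0x.
  by rewrite (negbTE nx0y).
apply: (@complete_bipartite_of_bipartition [set x | adj G x0 x] y0 x0).
- by rewrite inE.
- by rewrite inE adj_irr.
move=> x y; rewrite !inE.
case: (boolP (adj G x0 x)) => x0x; case: (boolP (adj G x0 y)) => x0y /=.
- exact: no_triangle x0x x0y.
- exact: cross.
- by rewrite adj_sym cross.
- by apply: (@no_triangle y0); rewrite nA.
Qed.

(** * The odd spanning tree of the complement *)

Section OddTree.
Variables u v c w : V.
Hypotheses (uv : adj G u v) (uc : ~~ adj G u c) (vc : ~~ adj G v c).
Hypotheses (wu : w != u) (wv : w != v) (wc : w != c).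
Hypotheses (cw : ~~ adj G c w) (vw : ~~ adj G v w).

(** The root is [c]. Hanging the neighbours of [v] below [u] uses only complement edges, since [u]
    and [v] have no common neighbour. *)
Definition odd_tree_parent x :=
  if x \in [:: c; u; v; w] then c else if adj G v x then u else v.

(** This is the depth in the tree rooted at [c]. *)
Definition odd_tree_rank x : nat :=
  if x == c then 0 else if x \in [:: u; v; w] then 1 else 2.

Let vu : adj G v u. Proof. by rewrite adj_sym. Qed.
Let uv' : u != v. Proof. by apply: contraTneq uv => ->; rewrite adj_irr. Qed.
Let cu : c != u. Proof. by apply: contraNneq vc => ->. Qed.
Let cv : c != v. Proof. by apply: contraNneq uc => ->. Qed.

Lemma odd_tree_rank_parent x :
  x != c -> odd_tree_rank (odd_tree_parent x) < odd_tree_rank x.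
Proof.
rewrite /odd_tree_rank /odd_tree_parent !inE => /negbTE->.
case: (boolP [|| x == u, x == v | x == w]) => _ /=; first by rewrite eqxx.
by case: (adj G v x); rewrite ?eqxx ?orbT [_ == c]eq_sym ?(negbTE cu) ?(negbTE cv).
Qed.

Let T := parent_graph odd_tree_parent.

Let neqs := (negbTE uv', negbTE cu, negbTE cv, negbTE wu, negbTE wv, negbTE wc).
Let neqsC := (eq_sym v u, eq_sym u c, eq_sym v c, eq_sym u w, eq_sym v w, eq_sym c w).
Let adjs := (adj_irr, vu, negbTE vc, negbTE vw).

Lemma odd_tree_adj_u y : adj T u y = (y == c) || (y != u) && adj G v y.
Proof.
rewrite /= /parent_adj /= /odd_tree_parent !inE ?neqsC ?neqs ?eqxx /=.
have [->|yc] := eqVneq y c; first by rewrite ?neqsC ?neqs ?eqxx.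
have [->|yu] := eqVneq y u; first by rewrite ?neqsC ?neqs ?eqxx.
have [->|yv] := eqVneq y v; first by rewrite ?neqsC ?neqs ?adjs.
have [->|yw] := eqVneq y w; first by rewrite ?neqsC ?neqs ?adjs.
by rewrite /=; case: ifP => _; rewrite ?eqxx // neqsC neqs.
Qed.

Lemma odd_tree_adj_v y : adj T v y = [&& y != v, y != w & ~~ adj G v y].
Proof.
rewrite /= /parent_adj /= /odd_tree_parent !inE ?neqsC ?neqs ?eqxx /=.
have [->|yc] := eqVneq y c; first by rewrite ?neqsC ?neqs ?adjs.
have [->|yu] := eqVneq y u; first by rewrite ?neqsC ?neqs ?adjs.
have [->|yv] := eqVneq y v; first by rewrite ?eqxx.
have [->|yw] := eqVneq y w; first by rewrite ?neqsC ?neqs.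
by rewrite /=; case: ifP => _; rewrite ?eqxx // neqs.
Qed.

Lemma odd_tree_adj_c y : adj T c y = (y \in [:: u; v; w]).
Proof.
rewrite /= /parent_adj /= /odd_tree_parent !inE !eqxx /= eq_sym.
have [->|yc] := eqVneq y c; first by rewrite ?neqsC ?neqs.
rewrite /=; case: ifP => _; first by rewrite eqxx.
by case: ifP => _; rewrite ?neqsC ?neqs.
Qed.

Lemma odd_tree_adj_leaf x y :
  x \notin [:: c; u; v] -> adj T x y = (y == odd_tree_parent x).
Proof.
rewrite !inE !negb_or => /and3P[xc xu xv]; rewrite /= /parent_adj /=.
have px : odd_tree_parent x != x.
  by rewrite /odd_tree_parent; do 2?case: ifP => _; rewrite eq_sym.
have py : (odd_tree_parent y == x) = false.
  by rewrite /odd_tree_parent; do 2?case: ifP => _; rewrite eq_sym; apply: negbTE.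
rewrite py orbF [x == y]eq_sym.
by have [->|_] := eqVneq y (odd_tree_parent x); rewrite ?andbF // px.
Qed.

Lemma odd_tree_deg : all_odd_deg T.
Proof.
move=> x; rewrite /deg.
have [->|xu] := eqVneq x u.
  (* Compared with the neighbourhood of [v] in [G], [u] is exchanged for [c], so the size is
     [deg G v]. *)
  have -> : [set y | adj T u y] = c |: ([set y | adj G v y] :\ u).
    by apply/setP => y; rewrite !inE odd_tree_adj_u.
  by have := oddG v; rewrite /deg (cardsD1 u) cardsU1 !inE cu (negbTE vc) vu.
have [->|xv] := eqVneq x v.
  (* The size is the order minus [deg G v] minus 2, where the order is even and [deg G v] odd. *)
  have -> : [set y | adj T v y] = (~: [set y | adj G v y] :\ w) :\ v.
    by apply/setP => y; rewrite !inE odd_tree_adj_v.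
  have := cardsD1 w (~: [set y | adj G v y]).
  have := cardsD1 v (~: [set y | adj G v y] :\ w).
  have := cardsC [set y | adj G v y].
  have := all_odd_deg_order oddG; have := oddG v.
  rewrite !inE adj_irr vw eq_sym wv /= /deg; lia.
have [->|xc] := eqVneq x c.
  have -> : [set y | adj T c y] = u |: [set v; w].
    by apply/setP => y; rewrite inE odd_tree_adj_c !inE.
  by rewrite cardsU1 cards2 !inE ?neqsC ?neqs.
have -> : [set y | adj T x y] = [set odd_tree_parent x].
  apply/setP => y; rewrite inE odd_tree_adj_leaf ?inE //.
  by rewrite !negb_or xc xu xv.
by rewrite cards1.
Qed.

Lemma odd_tree_parent_compl x :
  x != odd_tree_parent x -> compl_adj G x (odd_tree_parent x).
Proof.
rewrite /compl_adj /= => ->; rewrite /odd_tree_parent !inE /=.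
case: ifP => [/or4P[]/eqP->|_]; rewrite ?adj_irr //; first by rewrite adj_sym.
case: ifP => [vx|/negbT]; last by rewrite adj_sym.
by rewrite adj_sym (no_triangle vu vx).
Qed.

Lemma odd_tree_spanning : spanning_tree (compl G) T.
Proof.
split; last split.
- move=> x y /andP[xy /orP[]/eqP def]; move: xy; rewrite -def.
    exact: odd_tree_parent_compl.
  by rewrite eq_sym /= compl_sym; apply: odd_tree_parent_compl.
- by apply: parent_graph_connected odd_tree_rank_parent.
- apply: parent_graph_acyclic odd_tree_rank_parent _.
  by rewrite /odd_tree_parent inE eqxx.
Qed.

End OddTree.

(** * Edges that are not dominating *)

Lemma nondominating_edge_odd_spanning_tree u v c w :
    adj G u v -> ~~ adj G u c -> ~~ adj G v c ->
    w \notin [:: u; v; c] -> ~~ adj G c w ->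
  has_odd_spanning_tree (compl G).
Proof.
move=> uv uc vc; rewrite !inE !negb_or => /and3P[wu wv wc] cw.
(* A neighbour [w] of [v] is not one of [u], so the construction applies with [u] and [v]
   exchanged. *)
have [vw|vw] := boolP (adj G v w).
  have uw : ~~ adj G u w by rewrite adj_sym in uv; rewrite (no_triangle uv vw).
  exists (parent_graph (odd_tree_parent v u c w)).
  rewrite adj_sym in uv.
  by split; [apply: odd_tree_spanning | apply: odd_tree_deg].
exists (parent_graph (odd_tree_parent u v c w)).
by split; [apply: odd_tree_spanning | apply: odd_tree_deg].
Qed.

(** The neighbourhoods of [u] and [v] are disjoint and of odd size. Were [c] the only vertex outside
    them, the order would be odd. *)
Lemma second_undominated u v c :
    adj G u v -> ~~ adj G u c -> ~~ adj G v c ->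
  exists2 d, d != c & ~~ adj G u d && ~~ adj G v d.
Proof.
move=> uv uc vc.
have [d /and3P[dc ud vd]|none] :=
  pickP [pred d | [&& d != c, ~~ adj G u d & ~~ adj G v d]].
  by exists d; rewrite ?ud.
have := all_odd_deg_order oddG; have := oddG v; have := oddG u; rewrite /deg => ou ov.
suff -> : #|V| = #|c |: ([set x | adj G u x] :|: [set x | adj G v x])|.
  rewrite cardsU1 !inE (negbTE uc) (negbTE vc) cardsU.
  suff -> : [set x | adj G u x] :&: [set x | adj G v x] = set0.
    by rewrite cards0 subn0 !oddD ou ov.
  apply/setP => x; rewrite !inE; apply: negbTE; apply/andP => -[ux].
  by rewrite (no_triangle uv ux).
rewrite -cardsT; congr #|pred_of_set _|; apply/setP => x; rewrite !inE.
by have /= := none x; case: (x == c); case: (adj G u x); case: (adj G v x).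
Qed.

Lemma isomorphic_twoK2 u v c d :
    adj G u v -> adj G c d ->
    ~~ adj G u c -> ~~ adj G v c -> ~~ adj G u d -> ~~ adj G v d ->
    (forall x, x \in [:: u; v; c; d]) ->
  isomorphic G twoK2.
Proof.
move=> uv cd uc vc ud vd all4.
have neq_adj a b : adj G a b -> a != b by apply: contraTneq => ->; rewrite adj_irr.
have uv' := neq_adj _ _ uv; have cd' := neq_adj _ _ cd.
(* If [u] were [c], then [v] would be adjacent to [c]; the other three are similar. *)
have uc' : u != c by apply: contraNneq vc => <-; rewrite adj_sym.
have ud' : u != d by apply: contraNneq vd => <-; rewrite adj_sym.
have vc' : v != c by apply: contraNneq uc => <-.
have vd' : v != d by apply: contraNneq ud => <-.
pose neqs := (negbTE uv', negbTE cd', negbTE uc', negbTE ud', negbTE vc', negbTE vd').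
have neqsC := (eq_sym v u, eq_sym c u, eq_sym c v, eq_sym d u, eq_sym d v, eq_sym d c).
pose adjs := (@adj_irr _ G, uv, cd, negbTE uc, negbTE ud, negbTE vc, negbTE vd).
have symG x y : adj G x y = adj G y x by rewrite adj_sym.
have adjsC := (symG v u, symG c u, symG c v, symG d u, symG d v, symG d c).
pose f x := if x == u then (true, true) else if x == v then (true, false)
            else if x == c then (false, true) else (false, false).
exists f.
  exists (fun b => match b with
    | (true, true) => u | (true, false) => v | (false, true) => c | _ => d end).
    by move=> x; have := all4 x; rewrite !inE /f => /or4P[]/eqP->;
      rewrite ?neqsC ?neqs ?eqxx.
  by case=> [[] []]; rewrite /f ?neqsC ?neqs ?eqxx.
move=> x y; have := all4 x; have := all4 y; rewrite !inE /f.
by move=> /or4P[]/eqP-> /or4P[]/eqP->; rewrite ?neqsC ?neqs ?eqxx ?adjsC ?adjs.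
Qed.

(** If neither [c] nor [d] admits a further non-neighbour, each is adjacent to every vertex other
    than itself, [u] and [v]. So [c] and [d] are adjacent, and a fifth vertex would form a triangle
    with them. *)
Lemma nondominating_edge_odd_tree_or_twoK2 u v c :
    adj G u v -> ~~ adj G u c -> ~~ adj G v c ->
  has_odd_spanning_tree (compl G) \/ isomorphic G twoK2.
Proof.
move=> uv uc vc; have [d dc /andP[ud vd]] := second_undominated uv uc vc.
have [w /andP[wn cw]|fullc] := pickP [pred w | (w \notin [:: u; v; c]) && ~~ adj G c w].
  by left; apply: nondominating_edge_odd_spanning_tree wn cw.
have [w /andP[wn dw]|fulld] := pickP [pred w | (w \notin [:: u; v; d]) && ~~ adj G d w].
  by left; apply: nondominating_edge_odd_spanning_tree wn dw.
right.
have du : d != u by apply: contraNneq vd => ->; rewrite adj_sym.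
have dv : d != v by apply: contraNneq ud => ->.
have cd : adj G c d.
  by have := fullc d; rewrite /= !inE (negbTE du) (negbTE dv) (negbTE dc) => /negbFE.
apply: (@isomorphic_twoK2 u v c d) => // x.
have := fullc x; have := fulld x; rewrite /= !inE.
have [cx|_] := boolP (adj G c x).
  by rewrite (no_triangle cd cx) !andbT => /negbFE /or3P[]->; rewrite ?orbT.
by rewrite andbT => _ /negbFE /or3P[]->; rewrite ?orbT.
Qed.

End Graphs.

Theorem theorem4p2 (V : finType) (G : sgraph V) :
  triangle_free G -> all_odd_deg G ->
  (has_odd_spanning_tree (compl G) <->
   ~ isomorphic G twoK2 /\ ~ complete_bipartite G).
Proof.
move=> triG oddG; split=> [treeH | [notK2 notKst]].
  split=> [isoG|KstG]; first exact: twoK2_no_odd_spanning_tree treeH.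
  by case: treeH => T [spanT _]; apply: complete_bipartite_no_spanning_tree spanT.
(* On an empty vertex type the complement itself is vacuously an odd spanning tree. *)
have [x0 _|V0] := pickP (pred_of_simpl (@predT V)); last first.
  have noV (x : V) : False by have := V0 x.
  exists (compl G); split; last by move=> x; case: (noV x).
  by split=> //; split=> [x|[|x s] //]; case: (noV x).
have [/existsP[u /existsP[v /existsP[c /and3P[uv uc vc]]]]|dom] := boolP
    [exists u, exists v, exists c, [&& adj G u v, ~~ adj G u c & ~~ adj G v c]].
  by case: (nondominating_edge_odd_tree_or_twoK2 triG oddG uv uc vc).
case: notKst; apply: (dominating_edges_complete_bipartite triG oddG x0) => u v c uv.
apply: contraNT dom; rewrite negb_or => /andP[uc vc].
by apply/existsP; exists u; apply/existsP; exists v; apply/existsP; exists c; rewrite uv uc.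
Qed.
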